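(* Let $G=(V,E)$ be a finite undirected graph with $n=|V|$, let $d:E\to\mathbb{R}^+$, let $k,\alpha\ge2$ be integers, and put $\beta=n-(k-1)\alpha$. Let $\ell$ be an integer such that $\alpha\le\ell\le\beta$, let $S\subsetneq V$ be a proper subset with $|S|\ge\ell$, and let $\theta=\lfloor|S|/\ell\rfloor$. Then the inequality $$\sum_{i=\ell}^{\beta}\ \sum_{\substack{f\in\mathcal{F}(S):\\|f|=i}}x_f\ \le\ \min\{k-1,\theta\}$$ is valid for the model $(\mathcal{M}_3)$, where $\mathcal{F}(S)\subseteq\mathcal{F}$ is the subfamily of those $f\in\mathcal{F}$ that are contained in the induced subgraph $(S,E(S))$, i.e. whose nodes all lie in $S$.
   Context: $\mathcal{F}$ is the finite family of all induced connected subgraphs of $G$ (identified with their node sets) with number of nodes between $\alpha$ and $\beta$; $|f|$ is the number of nodes of $f\in\mathcal{F}$. $E(S)$ is the set of edges of $G$ with both end nodes in $S$. For $i\in V$ and $f\in\mathcal{F}$, $a_{if}=1$ if $f$ contains node $i$ and $a_{if}=0$ otherwise; $c_f\ge0$ is the total cost (under $d$) of the edges of $f$. Model $(\mathcal{M}_3)$: minimize $\sum_{f\in\mathcal{F}}c_fx_f$ subject to $\sum_{f\in\mathcal{F}}a_{if}x_f=1$ for all $i\in V$; $\sum_{f\in\mathcal{F}}x_f=k$; $x_f\in\{0,1\}$ for all $f\in\mathcal{F}$. An inequality is valid for the model if every feasible solution of the model satisfies it. *)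

(* Defs.v *)
From HB Require Import structures.
From mathcomp Require Import all_boot all_order all_algebra.

Set Implicit Arguments.
Unset Strict Implicit.
Unset Printing Implicit Defensive.

Import Order.TTheory GRing.Theory Num.Theory.

Local Open Scope ring_scope.

(* An edge is the set of its two end nodes; e is meant to be symmetric and
   irreflexive. *)
Definition edges (V : finType) (e : rel V) : {set {set V}} :=
  [set uv : {set V} | [exists u, exists v, e u v && (uv == [set u; v])]].

Definition edges_in (V : finType) (e : rel V) (S : {set V}) : {set {set V}} :=
  [set uv in edges e | uv \subset S].

Definition induced_rel (V : finType) (e : rel V) (S : {set V}) : rel V :=
  [rel u v | [&& u \in S, v \in S & e u v]].

Definition induced_connected (V : finType) (e : rel V) (f : {set V}) : bool :=
  (f != set0) &&
  [forall u in f, forall v in f, connect (induced_rel e f) u v].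

(* The subtraction is truncated.  When n < (k - 1) * alpha it yields 0 instead
   of a negative bound; for 0 < alpha no node set f satisfies
   alpha <= #|f| <= beta in either case. *)
Definition beta (n k alpha : nat) : nat := (n - (k - 1) * alpha)%N.

(* An induced subgraph is identified with its node set. *)
Definition family_of (V : finType) (e : rel V) (k alpha : nat) :
    {set {set V}} :=
  [set f : {set V} | induced_connected e f &&
                     (alpha <= #|f| <= beta #|V| k alpha)%N].

Definition subfamily_of (V : finType) (e : rel V) (k alpha : nat)
    (S : {set V}) : {set {set V}} :=
  [set f in family_of e k alpha | f \subset S].

Definition incidence (R : nzRingType) (V : finType) (i : V) (f : {set V}) : R :=
  (i \in f)%:R.

Definition cost (R : nzRingType) (V : finType) (e : rel V)
    (d : {set V} -> R) (f : {set V}) : R :=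
  \sum_(uv in edges_in e f) d uv.

Record min_model (X : Type) (R : Type) := MinModel {
  feasible : X -> Prop;
  objective : X -> R
}.

Definition valid_inequality (X R : Type) (M : min_model X R)
    (ineq : X -> Prop) : Prop :=
  forall x : X, feasible M x -> ineq x.

(* The variables are x_f for f in the family; x is total on {set V}, but its
   values outside the family are unconstrained and never used. *)
Definition M3_feasible (R : nzRingType) (V : finType) (e : rel V)
    (k alpha : nat) (x : {set V} -> R) : Prop :=
  [/\ forall i : V, \sum_(f in family_of e k alpha) incidence R i f * x f = 1,
      \sum_(f in family_of e k alpha) x f = k%:R
    & forall f : {set V}, f \in family_of e k alpha -> x f = 0 \/ x f = 1].

Definition M3 (R : nzRingType) (V : finType) (e : rel V) (d : {set V} -> R)
    (k alpha : nat) : min_model ({set V} -> R) R :=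
  {| feasible := M3_feasible e k alpha;
     objective := fun x => \sum_(f in family_of e k alpha) cost e d f * x f |}.

(* Main.v *)
(** The node sets [f] with [x_f = 1] partition [V] into [k] parts. Those lying in
    [S] and of size at least [l] are disjoint subsets of [S], so there are at most
    [#|S| %/ l] of them; and a node outside [S] is covered by a part that is not
    among them, so there are at most [k - 1]. *)

Require Import Defs.
From HB Require Import structures.
From mathcomp Require Import all_boot all_order all_algebra.

Set Implicit Arguments.
Unset Strict Implicit.
Unset Printing Implicit Defensive.

Import Order.TTheory GRing.Theory Num.Theory.

Local Open Scope ring_scope.

(** Terms with value 0 vanish and each other term adds 1. This turns the sums of the model into
    cardinals. *)
Lemma sum01_card (R : nzRingType) (I : finType) (A P : {pred I}) (x : I -> R) :
    {in A, forall i, x i = 0 \/ x i = 1} ->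
  \sum_(i in A | P i) x i = #|[set i in A | P i & x i == 1]|%:R.
Proof.
move=> x01; rewrite -sum1_card natr_sum (bigID (fun i => x i == 1)) /=.
rewrite [X in _ + X]big1 ?addr0 => [|i /andP[/andP[Ai _] xi]]; last first.
  by case: (x01 i Ai) => // xi1; rewrite xi1 eqxx in xi.
apply: eq_big => [i|i /andP[_ /eqP->]] //.
by rewrite inE andbA.
Qed.

(** After exchanging the sums, each [f] is met only at [i = #|f|], an index that [b] keeps below the
    upper end of the range. *)
Lemma sum_by_card (R : nmodType) (T : finType) (A : {pred {set T}})
    (x : {set T} -> R) (l b : nat) :
    {in A, forall f : {set T}, (#|f| <= b)%N} ->
  \sum_(l <= i < b.+1) \sum_(f in A | #|f| == i) x f
    = \sum_(f in A | (l <= #|f|)%N) x f.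
Proof.
move=> le_b; rewrite (exchange_big_dep (mem A)) => [|i f _ /andP[]] //=.
rewrite [RHS]big_mkcondr; apply: eq_bigr => f Af.
rewrite (eq_bigl (fun i => i == #|f|)) => [|i]; last first.
  by rewrite Af eq_sym.
by rewrite big_nat1_eq ltnS le_b ?andbT.
Qed.

(** Double counting of the pairs [(f, i)] with [i \in f]: each [f] in [Q] gives at least [l] of
    them, each [i] in [S] at most one. *)
Lemma card_packing (T : finType) (S : {set T}) (Q : {set {set T}}) (l : nat) :
    {in Q, forall f : {set T}, (f \subset S) && (l <= #|f|)%N} ->
    {in S, forall i : T, (#|[set f in Q | i \in f]| <= 1)%N} ->
  (#|Q| * l <= #|S|)%N.
Proof.
move=> QP packS; rewrite -sum_nat_const.
apply: (@leq_trans (\sum_(f in Q) \sum_(i in S | i \in f) 1)).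
  apply: leq_sum => f /QP /andP[/subsetP fS /leq_trans-> //].
  rewrite -sum1_card [leqRHS](eq_bigl (mem f)) // => i /=.
  by rewrite andb_idl // => /fS.
rewrite (exchange_big_dep (mem S)) => [|f i _ /andP[]] //=.
rewrite -[leqRHS]sum1_card; apply: leq_sum => i Si.
apply: leq_trans (packS i Si); rewrite -sum1_card leq_eqVlt.
by apply/orP; left; apply/eqP/eq_bigl => f; rewrite inE Si.
Qed.

Theorem theorem13 (R : realFieldType) (V : finType) (e : rel V)
    (e_sym : symmetric e) (e_irr : irreflexive e)
    (d : {set V} -> R) (d_ge0 : forall uv, uv \in edges e -> 0 <= d uv)
    (k alpha : nat) (k_ge2 : (2 <= k)%N) (alpha_ge2 : (2 <= alpha)%N)
    (l : nat) (l_bounds : (alpha <= l <= beta #|V| k alpha)%N)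
    (S : {set V}) (S_proper : S \proper [set: V]) (S_ge_l : (l <= #|S|)%N) :
  valid_inequality (M3 e d k alpha)
    (fun x : {set V} -> R =>
       \sum_(l <= i < (beta #|V| k alpha).+1)
         \sum_(f in subfamily_of e k alpha S | #|f| == i) x f
       <= (minn (k - 1) (#|S| %/ l))%:R).
Proof.
move=> x [x_cover x_card x01] /=.
set F := family_of e k alpha in x_cover x_card x01 *.
pose P := [set f in F | x f == 1].
have cardP : #|P| = k.
  apply/eqP; rewrite -(eqr_nat R) -x_card.
  (* The trivial filter [predT] gives the sum the shape required by [sum01_card]. *)
  rewrite [X in _ == X](eq_bigl (fun f => (f \in F) && predT f)) => [|f].
    by rewrite (sum01_card _ x01).
  by rewrite andbT.
have cover1 i : #|[set f in P | i \in f]| = 1%N.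
  have := x_cover i.
  rewrite (eq_bigr (fun f : {set V} => if i \in f then x f else 0))
    => [|f _]; last first.
    by rewrite /incidence; case: ifP => _; rewrite ?mul1r ?mul0r.
  rewrite -big_mkcondr (sum01_card _ x01) => /eqP.
  rewrite (eqr_nat R _ 1) => /eqP <-; apply/eq_card => f.
  by rewrite !inE -andbA (andbC (x f == 1)).
have subF : {subset subfamily_of e k alpha S <= F}.
  by move=> f; rewrite inE => /andP[].
rewrite sum_by_card => [|f /subF]; last by rewrite inE => /and3P[].
rewrite sum01_card => [|f /subF /x01] //.
(* The left-hand side is now [#|Q|], where [Q] holds the chosen parts inside [S] with at least [l]
   nodes. *)
set Q := [set f in _ | _ & _]; rewrite ler_nat leq_min.
have QP f : f \in Q -> [/\ f \in P, f \subset S & (l <= #|f|)%N].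
  by rewrite [f \in Q]inE [f \in subfamily_of _ _ _ _]inE [f \in P]inE
    => /and3P[/andP[-> ->] -> ->].
apply/andP; split.
  (* The part [f] covering a node [i] outside [S] is in [P] but not in [Q], so [Q] is a proper
     subset of [P]. *)
  have [_ [i _ iNS]] := properP S_proper.
  have /card_gt0P[f] : (0 < #|[set f in P | i \in f]|)%N by rewrite cover1.
  rewrite inE => /andP[Pf fi].
  rewrite leq_subRL ?(ltnW k_ge2) // add1n -cardP; apply/proper_card/properP.
  split; first by apply/subsetP => g /QP[].
  by exists f => //; apply: contra iNS => /QP[_ /subsetP fS _]; apply: fS.
have l_gt0 : (0 < l)%N.
  by case/andP: l_bounds => /(leq_trans alpha_ge2)/ltnW.
rewrite leq_divRL //; apply: card_packing => [f /QP[_ -> ->]|i _] //.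
(* Parts of [Q] through [i] are among those of [P], of which there is exactly one. *)
rewrite -(cover1 i); apply/subset_leq_card/subsetP => f.
by rewrite !inE => /andP[/and3P[/andP[-> _] _ ->] ->].
Qed.
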